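(* Consider the problem $\min_{x\in\mathbb{R}^n}f(x):=\|F(x)\|$ under the setting described in the context. Let $M-\|L_p\|>0$, let $(x_k)_{k\ge 0}$ be generated by the RHOTA algorithm, let $\mu>M+\|L_p\|$, and for every $k\ge 0$ let $y_{k+1}\in\arg\min_{y\in\mathbb{R}^n}f(y)+\frac{\mu}{(p+1)!}\|y-x_k\|^{p+1}$. Assume that for some $\delta\ge 0$ and every $k\ge 0$ $$s_M(x_{k+1};x_k)-\min_{y:\ \|y-x_k\|\le D_k}s_M(y;x_k)\le\frac{\delta}{(p+1)!}\|x_{k+1}-x_k\|^{p+1},\qquad D_k:=\left(\tfrac{(p+1)!}{\mu}(f(x_k)-f^* )\right)^{\frac1{p+1}}.$$ Assume additionally that there is $\sigma>0$ with $\sigma_{\min}(\nabla F(x))\ge\sigma>0$ for all $x\in\mathcal{L}(x_0)$. Denote $$L_\mu=\frac{\mu+\delta+\|L_p\|-M}{\mu-(M+\|L_p\|)},\qquad C_\sigma=\frac{M-\|L_p\|}{(p+1)!\,L_\mu}\left(\frac{p!\,\sigma}{\mu}\right)^{\frac{p+1}{p}}.$$ Then there exists a finite $k\in\{0,1,\dots,\bar k\}$, with $\bar k=\left\lceil\frac{f(x_0)}{C_\sigma}\right\rceil$, such that either $F(x_k)=0$, or ($k\ge 1$ and) $F(y_k)=0$.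
   Context: Setting: $p\ge 1$ is an integer, $m\le n$, and $F=(F_1,\dots,F_m):\mathbb{R}^n\to\mathbb{R}^m$, where each $F_i:\mathbb{R}^n\to\mathbb{R}$ is $p$ times differentiable with $p$th derivative Lipschitz continuous with constant $L_p^i$. The system $F(x)=0$ is assumed to have a solution; $f^*$ is a real number with $\inf f\ge f^*$. $L_p=(L_p^1,\dots,L_p^m)$ and $\|\cdot\|$ is the Euclidean norm. Notation: $T_p^{F_i}(y;x)=F_i(x)+\sum_{j=1}^p\frac1{j!}D^jF_i(x)[y-x]^j$, $T_p^F=(T_p^{F_1},\dots,T_p^{F_m})$, and for $M>0$ $$s_M(y;x):=\left\|T_p^F(y;x)\right\|+\frac{M}{(p+1)!}\|y-x\|^{p+1}.$$ RHOTA algorithm: given $x_0\in\mathbb{R}^n$ and $M>0$, for each $k\ge 0$ take any $x_{k+1}$ with $s_M(x_{k+1};x_k)\le s_M(x_k;x_k)$. $\mathcal{L}(x_0)=\{x\in\mathbb{R}^n:f(x)\le f(x_0)\}$. $\sigma_{\min}(\nabla F(x))$ is the smallest of the $m$ singular values of the Jacobian of $F$ at $x$, so $\sigma_{\min}(\nabla F(x))\ge\sigma$ means $\left\|\sum_{i=1}^md_i\nabla F_i(x)\right\|\ge\sigma\|d\|$ for all $d\in\mathbb{R}^m$. *)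

(* Defs.v *)
From HB Require Import structures.
From mathcomp Require Import all_boot all_order all_algebra.
From mathcomp Require Import all_classical all_reals all_analysis.

Set Implicit Arguments.
Unset Strict Implicit.
Unset Printing Implicit Defensive.

Import Order.TTheory GRing.Theory Num.Theory.
Import numFieldNormedType.Exports.

Local Open Scope classical_set_scope.
Local Open Scope ring_scope.

(* Euclidean norm: the library norm `|u| on 'rV[R]_n is the sup norm. *)
Definition enorm (R : realType) (n : nat) (u : 'rV[R]_n) : R :=
  Num.sqrt (\sum_(i < n) u 0 i ^+ 2).

(* iterD g [:: h_1; ...; h_j] x is D^j g(x)[h_1, ..., h_j]. *)
Fixpoint iterD (R : realType) (n : nat) (g : 'rV[R]_n -> R)
    (hs : seq 'rV[R]_n) : 'rV[R]_n -> R :=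
  if hs is h :: hs' then fun x => 'D_h (iterD g hs') x else g.

(* For j < p, D^j g is (Frechet) differentiable as a map into the
   finite-dimensional space of j-linear forms, i.e. all its evaluations at
   (h_1, ..., h_j) are. *)
Definition times_differentiable (R : realType) (n p : nat)
    (g : 'rV[R]_n -> R) : Prop :=
  forall (hs : seq 'rV[R]_n), (size hs < p)%N ->
    forall x, differentiable (iterD g hs) x.

(* The operator norm of the p-linear form D^p g(y) - D^p g(x), for the
   Euclidean norm, is at most L * enorm (y - x). *)
Definition lipschitz_deriv (R : realType) (n p : nat)
    (g : 'rV[R]_n -> R) (L : R) : Prop :=
  forall (x y : 'rV[R]_n) (hs : seq 'rV[R]_n), size hs = p ->
    `|iterD g hs y - iterD g hs x|
      <= L * enorm (y - x) * \prod_(h <- hs) enorm h.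

Definition taylor1 (R : realType) (n p : nat) (g : 'rV[R]_n -> R)
    (y x : 'rV[R]_n) : R :=
  g x + \sum_(1 <= j < p.+1) (j`!%:R)^-1 * iterD g (nseq j (y - x)) x.

Definition taylor (R : realType) (n m p : nat) (F : 'rV[R]_n -> 'rV[R]_m)
    (y x : 'rV[R]_n) : 'rV[R]_m :=
  \row_(i < m) taylor1 p (fun z => F z 0 i) y x.

Definition smodel (R : realType) (n m p : nat) (F : 'rV[R]_n -> 'rV[R]_m)
    (M : R) (y x : 'rV[R]_n) : R :=
  enorm (taylor p F y x) + M / (p.+1)`!%:R * enorm (y - x) ^+ p.+1.

Definition rhota (R : realType) (n m p : nat) (F : 'rV[R]_n -> 'rV[R]_m)
    (M : R) (x : nat -> 'rV[R]_n) : Prop :=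
  forall k, smodel p F M (x k.+1) (x k) <= smodel p F M (x k) (x k).

Definition is_argmin (R : realType) (T : Type) (g : T -> R) (z : T) : Prop :=
  forall z', g z <= g z'.

(* A matrix with m <= n has m singular values, the square roots of the
   eigenvalues of A *m A^T. *)
Definition singular_value (R : realType) (m n : nat) (A : 'M[R]_(m, n))
    (s : R) : Prop :=
  0 <= s /\ eigenvalue (A *m A^T) (s ^+ 2).

(* For 0 < m the set is finite and nonempty, so that inf is a minimum. *)
Definition sigma_min (R : realType) (m n : nat) (A : 'M[R]_(m, n)) : R :=
  inf [set s | singular_value A s].

(* The library's 'J acts on row vectors on the right: it is the transpose of
   the m x n matrix with rows grad F_i (x). *)
Definition jac (R : realType) (n m : nat) (F : 'rV[R]_n -> 'rV[R]_m)
    (x : 'rV[R]_n) : 'M[R]_(m, n) := ('J F x)^T.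

(* Main.v *)
Require Import Defs.
From HB Require Import structures.
From mathcomp Require Import all_boot all_order all_algebra.
From mathcomp Require Import all_classical all_reals all_analysis.
From mathcomp Require Import ring lra.

Set Implicit Arguments.
Unset Strict Implicit.
Unset Printing Implicit Defensive.

Import Order.TTheory GRing.Theory Num.Theory.
Import numFieldNormedType.Exports.

Local Open Scope classical_set_scope.
Local Open Scope ring_scope.

(** Taylor's bound puts the model [smodel p F M y x] within
    [(M +- enorm L) / (p+1)! * enorm (y - x)^(p+1)] of [enorm (F y)]. Hence each
    step decreases [f] by at least [(M - enorm L) / (p+1)!] times
    [r := enorm (x_(k+1) - x_k)^(p+1)], and comparing the models at [x_(k+1)]
    and at the proximal point [y_(k+1)] gives
    [enorm (y_(k+1) - x_k)^(p+1) <= Lmu * r]. If [F y_(k+1) != 0], stationarity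
    of [y_(k+1)] and nondegeneracy of the Jacobian force
    [p! * sigma / mu <= enorm (y_(k+1) - x_k)^p], so that the step decreases [f]
    by at least [Csigma]; this cannot happen more than [f x_0 / Csigma] times
    before [f] reaches [0]. *)

(** * Euclidean inner product, norm and smallest singular value *)

Section euclidean.
Context {R : realType}.

(** Written as a matrix product so that passing to the adjoint is mere associativity. *)
Definition edot n (u v : 'rV[R]_n) : R := (u *m v^T) 0 0.

Lemma edotE n (u v : 'rV[R]_n) : edot u v = \sum_i u 0 i * v 0 i.
Proof. by rewrite /edot mxE; apply: eq_bigr => i _; rewrite mxE. Qed.

Lemma edotC n (u v : 'rV[R]_n) : edot u v = edot v u.
Proof. by rewrite !edotE; apply: eq_bigr => i _; rewrite mulrC. Qed.

Lemma edotDl n (u v w : 'rV[R]_n) : edot (u + v) w = edot u w + edot v w.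
Proof. by rewrite /edot mulmxDl mxE. Qed.

Lemma edotZl n a (u v : 'rV[R]_n) : edot (a *: u) v = a * edot u v.
Proof. by rewrite /edot -scalemxAl mxE. Qed.

Lemma edotDr n (u v w : 'rV[R]_n) : edot w (u + v) = edot w u + edot w v.
Proof. by rewrite edotC edotDl !(edotC w). Qed.

Lemma edotZr n a (u v : 'rV[R]_n) : edot v (a *: u) = a * edot v u.
Proof. by rewrite edotC edotZl edotC. Qed.

Lemma edot0l n (u : 'rV[R]_n) : edot 0 u = 0.
Proof. by rewrite /edot mul0mx mxE. Qed.

Lemma edot_mulmx n m (A : 'M[R]_(n, m)) u v :
  edot (u *m A) v = edot u (v *m A^T).
Proof. by rewrite /edot trmx_mul trmxK mulmxA. Qed.

Lemma edot_ge0 n (u : 'rV[R]_n) : 0 <= edot u u.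
Proof. by rewrite edotE sumr_ge0// => i _; rewrite -expr2 sqr_ge0. Qed.

Lemma edot_eq0 n (u : 'rV[R]_n) : (edot u u == 0) = (u == 0).
Proof.
apply/idP/eqP => [|->]; last by rewrite edot0l.
rewrite edotE psumr_eq0 => [/allP u0|i _]; last by rewrite -expr2 sqr_ge0.
apply/rowP => i; rewrite mxE; apply/eqP.
by have := u0 i (mem_index_enum _); rewrite /= mulf_eq0 orbb.
Qed.

Lemma enormE n (u : 'rV[R]_n) : enorm u = Num.sqrt (edot u u).
Proof.
by rewrite edotE; congr Num.sqrt; apply: eq_bigr => i _; rewrite expr2.
Qed.

Lemma sqr_enorm n (u : 'rV[R]_n) : enorm u ^+ 2 = edot u u.
Proof. by rewrite enormE sqr_sqrtr// edot_ge0. Qed.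

Lemma enorm_ge0 n (u : 'rV[R]_n) : 0 <= enorm u.
Proof. exact: sqrtr_ge0. Qed.

Lemma enorm_eq0 n (u : 'rV[R]_n) : (enorm u == 0) = (u == 0).
Proof. by rewrite -edot_eq0 -sqr_enorm expf_eq0. Qed.

Lemma enorm0 n : enorm (0 : 'rV[R]_n) = 0.
Proof. by apply/eqP; rewrite enorm_eq0. Qed.

Lemma enorm_gt0 n (u : 'rV[R]_n) : (0 < enorm u) = (u != 0).
Proof. by rewrite lt_def enorm_eq0 enorm_ge0 andbT. Qed.

Lemma enormZ n a (u : 'rV[R]_n) : enorm (a *: u) = `|a| * enorm u.
Proof.
apply/eqP; rewrite -(eqrXn2 (ltn0Sn 1)) ?enorm_ge0 ?mulr_ge0 ?enorm_ge0//.
by rewrite exprMn !sqr_enorm edotZl edotZr mulrA real_normK ?num_real.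
Qed.

(** Cauchy-Schwarz: expand the square of [enorm v *: u - enorm u *: v] and divide by the positive
    factor [enorm u * enorm v]. *)
Lemma edot_le n (u v : 'rV[R]_n) : edot u v <= enorm u * enorm v.
Proof.
have [->|u0] := eqVneq u 0; first by rewrite enorm0 edot0l mul0r.
have [->|v0] := eqVneq v 0; first by rewrite enorm0 edotC edot0l mulr0.
have uv : 0 < enorm u * enorm v by rewrite mulr_gt0// enorm_gt0.
have := edot_ge0 (enorm v *: u + (- enorm u) *: v).
rewrite !(edotDl, edotDr, edotZl, edotZr) (edotC v u) -!sqr_enorm => h.
rewrite -(ler_pM2l uv) -subr_ge0 -(pmulr_rge0 _ (ltr0Sn R 1)).
by lra.
Qed.

Lemma ler_enormD n (u v : 'rV[R]_n) : enorm (u + v) <= enorm u + enorm v.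
Proof.
rewrite -(ler_pXn2r (ltn0Sn 1)) ?nnegrE ?addr_ge0 ?enorm_ge0//.
rewrite sqrrD !sqr_enorm edotDl !edotDr (edotC v u) addrA -(addrA (edot u u)).
by rewrite -mulr2n lerD2r lerD2l lerMn2r edot_le orbT.
Qed.

(** Lets the Taylor bounds of the components, with constants [L 0 i], combine into one with constant
    [enorm L]. *)
Lemma ler_enorm_coord n (u v : 'rV[R]_n) c : 0 <= c ->
  (forall i, `|u 0 i| <= v 0 i * c) -> enorm u <= enorm v * c.
Proof.
move=> c0 uv; rewrite -(ger0_norm c0) mulrC -enormZ.
rewrite -(ler_pXn2r (ltn0Sn 1)) ?nnegrE ?enorm_ge0// !sqr_enorm !edotE.
apply: ler_sum => i _; rewrite mxE -!expr2 -real_normK ?num_real//.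
by rewrite mulrC lerXn2r ?nnegrE//; apply: le_trans (uv i).
Qed.

(** At [t = - a / (|b| + 1)] the value is a square times the negative number [b - (|b| + 1)], so the
    square vanishes. *)
Lemma quadratic_ge0_linear0 (a b : R) :
  (forall t, 0 <= a * t + b * t ^+ 2) -> a = 0.
Proof.
move=> h; have b1 : 0 < `|b| + 1 by rewrite ltr_wpDl.
have := h (- a / (`|b| + 1)).
have -> : a * (- a / (`|b| + 1)) + b * (- a / (`|b| + 1)) ^+ 2
  = (a / (`|b| + 1)) ^+ 2 * (b - (`|b| + 1)) by field; rewrite gt_eqF.
rewrite nmulr_lge0; last by rewrite subr_lt0 (le_lt_trans (ler_norm b))// ltrDl.
rewrite real_exprn_even_le0 ?num_real//= mulf_eq0 invr_eq0 (gt_eqF b1) orbF.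
by move=> /eqP.
Qed.

Lemma continuous_edot_mulmx m n (A : 'M[R]_(m, n)) :
  continuous (fun u : 'rV[R]_m => edot (u *m A) (u *m A)).
Proof.
move=> u; apply: differentiable_continuous.
have -> : (fun u : 'rV[R]_m => edot (u *m A) (u *m A)) =
  \sum_(i < n) (fun u => (u *m A) 0 i) ^+ 2.
  apply/funext => w; rewrite edotE fct_sumE; apply: eq_bigr => i _.
  by rewrite expr2.
apply: differentiable_sum => i; apply: differentiableX.
have -> : (fun u : 'rV[R]_m => (u *m A) 0 i) =
  \sum_(j < m) (A j i \*: (fun u : 'rV[R]_m => u 0 j)).
  apply/funext => w; rewrite mxE fct_sumE; apply: eq_bigr => j _.
  by rewrite mulrC.
apply: differentiable_sum => j; apply: differentiableZ.
exact: differentiable_coord.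
Qed.

(* The minimum of the Rayleigh quotient of [A *m A^T] over the unit sphere is
   attained, and a minimizer is an eigenvector. *)
Lemma sigma_min_le m n (A : 'M[R]_(m, n)) (d : 'rV[R]_m) :
  sigma_min A * enorm d <= enorm (d *m A).
Proof.
have [->|d0] := eqVneq d 0; first by rewrite enorm0 mulr0 enorm_ge0.
pose S := [set u : 'rV[R]_m | edot u u = 1].
have normalize (u : 'rV[R]_m) : u != 0 -> S ((enorm u)^-1 *: u).
  move=> u0; rewrite /S /= edotZl edotZr -sqr_enorm.
  by field; rewrite enorm_eq0.
have S0 : S !=set0 by exists ((enorm d)^-1 *: d); exact: normalize.
have Scompact : compact S.
  apply: bounded_closed_compact.
    (* The library norm is the sup norm; each squared coordinate is at most [edot u u = 1]. *)
    exists 1; split => // M M1 u Su /=; rewrite [leLHS]/Num.norm/= mx_normrE.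
    apply: bigmax_le => [|[i j] _]; first exact: le_trans (ltW M1).
    apply: le_trans (ltW M1); rewrite ord1 /=.
    rewrite -(ler_pXn2r (ltn0Sn 1)) ?nnegrE// expr1n real_normK ?num_real//.
    rewrite -Su edotE (bigD1 j)//= -expr2 lerDl sumr_ge0// => k _.
    by rewrite -expr2 sqr_ge0.
  rewrite (_ : S =
    (fun u : 'rV[R]_m => edot (u *m 1%:M) (u *m 1%:M)) @^-1` [set 1]).
    apply: preimage_closed; last exact: closed_eq.
    by move=> u _; exact: continuous_edot_mulmx.
  by apply/seteqP; split=> u; rewrite /S /= mulmx1.
have [u] := EVT_min_rV S0 Scompact
  (continuous_subspaceT (@continuous_edot_mulmx _ _ A)).
rewrite inE => Su umin; set l := edot (u *m A) (u *m A) in umin.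
(* By homogeneity, minimality on the sphere extends to all vectors. *)
have lmin v : l * edot v v <= edot (v *m A) (v *m A).
  have [->|v0] := eqVneq v 0; first by rewrite mul0mx !edot0l mulr0.
  have := umin _ (mem_set (normalize _ v0)).
  rewrite -scalemxAl edotZl edotZr -(sqr_enorm v) => h.
  have v2 : 0 < enorm v ^+ 2 by rewrite exprn_gt0// enorm_gt0.
  rewrite -ler_pdivlMr//; apply: le_trans h _.
  by rewrite mulrA -expr2 exprVn mulrC.
have eig : eigenvalue (A *m A^T) l.
  apply/eigenvalueP; exists u; last first.
    by rewrite -edot_eq0 Su oner_eq0.
  (* Perturb [u] along the residual [z] of the eigenvector equation: [lmin (u + t *: z)] is a
     nonnegative quadratic in [t] with zero constant term and linear coefficient [2 * edot z z]. *)
  apply/eqP; rewrite -subr_eq0; set z := _ - _.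
  rewrite -edot_eq0; apply/eqP/(@mulfI _ 2); first by rewrite pnatr_eq0.
  rewrite mulr0.
  apply: (@quadratic_ge0_linear0 _ (edot (z *m A) (z *m A) - l * edot z z)).
  move=> t; have := lmin (u + t *: z).
  have zz : edot z z = edot (u *m A) (z *m A) - l * edot u z.
    rewrite {1}/z -scaleNr edotDl edotZl mulNr; congr (_ - _).
    by rewrite mulmxA (edot_mulmx A^T) trmxK.
  clearbody z; rewrite {1}zz !(mulmxDl, edotDl, edotDr).
  rewrite -!scalemxAl !(edotZl, edotZr) Su -/l.
  by rewrite (edotC (z *m A)) (edotC z u); lra.
have l0 : 0 <= l by exact: edot_ge0.
(* [Num.sqrt l] is a singular value, hence at least the infimum. *)
apply: (@le_trans _ _ (Num.sqrt l * enorm d)).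
  rewrite ler_wpM2r ?enorm_ge0//; apply: ge_inf; first by exists 0 => s [].
  by split; rewrite ?sqrtr_ge0// sqr_sqrtr.
rewrite -(ler_pXn2r (ltn0Sn 1)) ?nnegrE ?mulr_ge0 ?sqrtr_ge0 ?enorm_ge0//.
by rewrite exprMn sqr_sqrtr// !sqr_enorm.
Qed.

End euclidean.

(** * Taylor remainder bounds under a Lipschitz derivative of order [p] *)

Section taylor.
Context {R : realType}.

Lemma is_derive_line n (g : 'rV[R]_n -> R) (x h : 'rV[R]_n) (t df : R) :
  is_derive (x + t *: h) h g df ->
  is_derive t 1 (fun s => g (x + s *: h)) df.
Proof.
have E : (fun e : R =>
      e^-1 *: (g (x + (e *: (1 : R) + t) *: h) - g (x + t *: h))) =
    (fun e : R => e^-1 *: (g (e *: h + (x + t *: h)) - g (x + t *: h))).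
  apply/funext => e; congr (_ *: (g _ - _)).
  by rewrite [_%:A]mulr1 scalerDl addrCA.
by case=> dg <-; split; rewrite /derivable /derive /= E.
Qed.

Lemma is_derive1_ge0_le (f df : R -> R) (t : R) : 0 <= t ->
  (forall s : R, is_derive s 1 f (df s)) -> (forall s, 0 <= s -> 0 <= df s) ->
  f 0 <= f t.
Proof.
move=> t0 dfE df0; rewrite -subr_ge0.
have cf : {within `[0, t], continuous f}.
  apply: continuous_subspaceT => s; apply: differentiable_continuous.
  by apply/derivable1_diffP; have [] := dfE s.
have [c] := MVT_segment t0 (fun s _ => dfE s) cf.
rewrite in_itv /= => /andP[c0 _] ->.
by rewrite mulr_ge0 ?subr0// df0.
Qed.

(** Both [g - f] and [g + f] vanish at 0 and have nonnegative derivatives on the half-line. *)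
Lemma norm_le_of_derive (f df g dg : R -> R) (t : R) : 0 <= t ->
  f 0 = 0 -> g 0 = 0 ->
  (forall s : R, is_derive s 1 f (df s)) ->
  (forall s : R, is_derive s 1 g (dg s)) ->
  (forall s, 0 <= s -> `|df s| <= dg s) -> `|f t| <= g t.
Proof.
move=> t0 f0 g0 dfE dgE fg.
have := is_derive1_ge0_le t0 (fun s => is_deriveD (dgE s) (dfE s)).
have := is_derive1_ge0_le t0 (fun s => is_deriveB (dgE s) (dfE s)).
rewrite !fctE f0 g0 subr0 addr0 subr_ge0 => le1 le2.
rewrite ler_norml; apply/andP; split; last first.
  by apply: le1 => s /fg; rewrite ler_norml subr_ge0 => /andP[].
rewrite -subr_ge0 opprK addrC; apply: le2 => s /fg.
by rewrite ler_norml -subr_ge0 opprK addrC => /andP[].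
Qed.

Lemma is_derive_monomial (c t : R) k :
  is_derive t 1 (fun s => c * s ^+ k.+1 / k.+1`!%:R) (c * t ^+ k / k`!%:R).
Proof.
have -> : (fun s : R => c * s ^+ k.+1 / k.+1`!%:R) =
          (c / k.+1`!%:R) \*: (@id R) ^+ k.+1.
  by apply/funext => s; rewrite mulrAC /= exprfctE.
apply: is_derive_eq; rewrite /= factS natrM [_%:A]mulr1.
rewrite /GRing.scale /=; field.
by rewrite ?natr1 ?nat1r !pnatr_eq0 -lt0n fact_gt0.
Qed.

(** Induction on [p]: the shifted family [phi j.+1] satisfies the bound one order lower, and
    [norm_le_of_derive] integrates it. The base case is the Lipschitz hypothesis. *)
Lemma taylor_remainder p (phi : nat -> R -> R) (C : R) :
  (forall j (t : R), (j < p)%N -> is_derive t 1 (phi j) (phi j.+1 t)) ->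
  (forall t, 0 <= t -> `|phi p t - phi p 0| <= C * t) ->
  forall t, 0 <= t ->
  `|phi 0%N t - \sum_(j < p.+1) phi j 0 * t ^+ j / j`!%:R|
    <= C * t ^+ p.+1 / p.+1`!%:R.
Proof.
elim: p phi => [|p IH] phi dphi lip t t0.
  by rewrite big_ord1 !fact0 !divr1 mulr1 expr1; exact: lip.
pose T s := \sum_(j < p.+2) phi j 0 * s ^+ j / j`!%:R.
pose T' s := \sum_(j < p.+1) phi j.+1 0 * s ^+ j / j`!%:R.
have bound : forall s, 0 <= s ->
    `|phi 1%N s - T' s| <= C * s ^+ p.+1 / p.+1`!%:R.
  move=> s s0; apply: (IH (fun j => phi j.+1)) => // j r jp.
  exact: dphi.
have dT (s : R) : is_derive s 1 T (T' s).
  have -> : T = cst (phi 0%N 0) +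
      \sum_(j < p.+1) (fun s => phi j.+1 0 * s ^+ j.+1 / j.+1`!%:R).
    apply/funext => r; rewrite /T big_ord_recl expr0 fact0 divr1 mulr1.
    by rewrite [RHS]/= fctE fct_sumE.
  rewrite -[T' s]add0r; apply: is_deriveD.
  by apply: is_derive_sum => j; exact: is_derive_monomial.
have T0 : phi 0%N 0 - T 0 = 0.
  rewrite /T big_ord_recl expr0 fact0 divr1 mulr1 big1 ?addr0 ?subrr// => j _.
  by rewrite expr0n mulr0 mul0r.
have dphi0 (s : R) : is_derive s 1 (phi 0%N) (phi 1%N s) by exact: dphi.
have dP s := is_derive_monomial C s p.+1.
apply: (@norm_le_of_derive (phi 0%N - T) (fun s => phi 1%N s - T' s) _ _ t t0 T0
  _ (fun s => is_deriveB (dphi0 s) (dT s)) dP bound).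
by rewrite expr0n mulr0 mul0r.
Qed.

(** One-dimensional remainder bound along the segment from [x] to [y], evaluated at [t = 1]. *)
Lemma taylor1_le p n (g : 'rV[R]_n -> R) (L : R) (x y : 'rV[R]_n) :
  times_differentiable p g -> lipschitz_deriv p g L ->
  `|g y - taylor1 p g y x| <= L * (enorm (y - x) ^+ p.+1 / p.+1`!%:R).
Proof.
move=> dg lip; set h : 'rV[R]_n := y - x.
(* Qualified because [ssrnat.iterD] shadows it. *)
pose phi j (t : R) := Defs.iterD g (nseq j h) (x + t *: h).
(* Of the [p.+1] factors [enorm h], [p] come from the directions and one from the distance
   [t * enorm h]. *)
have := @taylor_remainder p phi (L * enorm h ^+ p.+1) _ _ 1 ler01.
have -> : phi 0%N 1 = g y by rewrite /phi /= scale1r addrC subrK.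
rewrite expr1n mulr1 mulrA big_ord_recl expr1n fact0 divr1 mulr1.
have -> : phi 0%N 0 + \sum_(i < p) phi (lift ord0 i) 0 * 1 ^+ (lift ord0 i) /
    (lift ord0 i)`!%:R = taylor1 p g y x.
  rewrite /taylor1 big_add1 big_mkord /phi scale0r addr0 /=; congr (_ + _).
  by apply: eq_bigr => j _; rewrite /bump /= add1n expr1n mulr1 mulrC.
apply => [j t jp|t t0].
  apply: is_derive_line; apply: derivableP; apply: diff_derivable.
  by apply: dg; rewrite size_nseq.
have := lip (x + 0 *: h) (x + t *: h) (nseq p h) (size_nseq _ _).
rewrite scale0r addr0 addrAC subrr add0r enormZ (ger0_norm t0) big_nseq.
rewrite /phi scale0r addr0 => /le_trans; apply.
by rewrite iter_mulr_1 exprS; lra.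
Qed.

Lemma taylor_le p n m (F : 'rV[R]_n -> 'rV[R]_m) (L : 'rV[R]_m) x y :
  (forall i, times_differentiable p (fun z => F z 0 i)) ->
  (forall i, lipschitz_deriv p (fun z => F z 0 i) (L 0 i)) ->
  enorm (F y - taylor p F y x) <= enorm L / p.+1`!%:R * enorm (y - x) ^+ p.+1.
Proof.
move=> dF lF; rewrite mulrAC -mulrA.
apply: ler_enorm_coord => [|i].
  by rewrite divr_ge0// exprn_ge0// enorm_ge0.
by rewrite !mxE; exact: taylor1_le.
Qed.

End taylor.

(** * First-order condition at the proximal point *)

Section stationarity.
Context {R : realType}.

(** The derivative is the limit of difference quotients over positive increments, all
    nonnegative. *)
Lemma is_derive_ge0_at_right (H : R -> R) (d : R) :
  is_derive (0 : R) 1 H d -> (forall t, 0 <= t -> H 0 <= H t) -> 0 <= d.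
Proof.
case=> dH <- Hmin; rewrite ['D_1 H 0]cvg_at_rightE; last exact: dH.
apply: limr_ge.
  rewrite -(cvg_at_rightE (fun h : R => h^-1 *: ((H \o shift 0) _ - H 0)))//.
  apply: cvg_trans dH; apply: cvg_app.
  by move=> A [e e0 Ae]; exists e => // h he h0; apply: Ae => //;
    exact: lt0r_neq0.
near=> h; have h0 : 0 < h by near: h; exact: nbhs_right_gt.
rewrite /= mulr_ge0 ?invr_ge0 ?(ltW h0)// subr_ge0 Hmin//.
by rewrite addr0 [_%:A]mulr1 ltW.
Unshelve. all: by end_near. Qed.

Lemma differentiable_row n m (F : 'rV[R]_n -> 'rV[R]_m) x :
  (forall i, differentiable (fun z => F z 0 i) x) -> differentiable F x.
Proof.
move=> dF; have -> : F = \sum_(i < m) (fun z => F z 0 i *: delta_mx 0 i).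
  by apply/funext => z; rewrite fct_sumE -row_sum_delta.
by apply: differentiable_sum => i; exact: differentiableZl.
Qed.

Lemma is_derive_coord n m (F : 'rV[R]_n -> 'rV[R]_m) (x v : 'rV[R]_n) i :
  differentiable F x ->
  is_derive x v (fun z => F z 0 i) ((v *m (jac F x)^T) 0 i).
Proof.
move=> dF; have dFv : derivable F x v by exact: diff_derivable.
rewrite trmxK -deriveEjacobian// derive_mx// mxE.
by apply: derivableP; move/derivable_mxP : dFv; exact.
Qed.

(* At a minimizer the slope of [enorm \o F] along [- w] cannot beat that of the
   regularization; squares avoid differentiating the norm, by
   [enorm (F z) <= (enorm (F z) ^+ 2 + enorm (F y) ^+ 2) / (2 * enorm (F y))]. *)
Lemma argmin_jac_le n m p (F : 'rV[R]_n -> 'rV[R]_m) mu x y :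
  0 <= mu -> differentiable F y -> F y != 0 ->
  is_argmin (fun z => enorm (F z) + mu / p.+1`!%:R * enorm (z - x) ^+ p.+1) y ->
  enorm (F y *m jac F y) <= mu / p`!%:R * enorm (y - x) ^+ p * enorm (F y).
Proof.
move=> mu0 dF; rewrite -enorm_gt0 => u0 ymin.
set w := F y *m jac F y; set q := enorm (y - x).
pose S t := \sum_(i < m) (F (y + t *: - w) 0 i) ^+ 2.
have SE t : S t = enorm (F (y + t *: - w)) ^+ 2.
  by rewrite sqr_enorm edotE; apply: eq_bigr => i _; rewrite expr2.
(* Up to the constant [enorm (F y) / 2], [H] majorizes the objective along the ray and equals it at
   [t = 0]; so [H 0 <= H t] follows from minimality of [y]. *)
pose H t := (2 * enorm (F y))^-1 * S t +
  mu / p.+1`!%:R * (q + t * enorm w) ^+ p.+1.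
have Hmin t : 0 <= t -> H 0 <= H t.
  move=> t0; rewrite /H !SE mul0r addr0 scale0r addr0.
  set z := y + _.
  have zx : enorm (z - x) <= q + t * enorm w.
    rewrite /z addrAC; apply: le_trans (ler_enormD _ _) _.
    by rewrite -/q lerD2l enormZ -scaleN1r enormZ normrN1 mul1r ger0_norm.
  have := ymin z; rewrite -/q => h.
  have hc : mu / p.+1`!%:R * enorm (z - x) ^+ p.+1
      <= mu / p.+1`!%:R * (q + t * enorm w) ^+ p.+1.
    apply: ler_wpM2l; first by rewrite divr_ge0.
    by rewrite lerXn2r ?nnegrE ?enorm_ge0// (le_trans _ zx) ?enorm_ge0.
  have amgm : enorm (F z) <=
     (2 * enorm (F y))^-1 * enorm (F z) ^+ 2 + enorm (F y) / 2.
    rewrite -subr_ge0.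
    have -> : (2 * enorm (F y))^-1 * enorm (F z) ^+ 2 + enorm (F y) / 2 -
        enorm (F z) = (2 * enorm (F y))^-1 * (enorm (F z) - enorm (F y)) ^+ 2.
      by field; rewrite gt_eqF.
    by rewrite mulr_ge0 ?sqr_ge0// invr_ge0 mulr_ge0// ltW.
  have -> : (2 * enorm (F y))^-1 * enorm (F y) ^+ 2 = enorm (F y) / 2.
    by field; rewrite gt_eqF.
  by lra.
have dS : is_derive (0 : R) 1 S (- 2 * enorm w ^+ 2).
  have -> : S = \sum_(i < m) (fun t => F (y + t *: - w) 0 i) ^+ 2.
    by apply/funext => t; rewrite fct_sumE.
  (* By adjunction, pairing [F y] with [w *m (jac F y)^T] is pairing [w] with itself. *)
  have -> : - 2 * enorm w ^+ 2 = \sum_(i < m)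
     (2%:R * F y 0 i ^+ 1) *: ((- w) *m (jac F y)^T) 0 i.
    under eq_bigr do rewrite expr1 -scalerA.
    rewrite -scaler_sumr -edotE -edot_mulmx -/w -(scaleN1r w) edotZr sqr_enorm.
    by rewrite /GRing.scale/=; lra.
  apply: is_derive_sum => i.
  have := @is_derive_coord _ _ F y (- w) i dF.
  rewrite -{1}(addr0 y) -(scale0r (- w)) => /is_derive_line dFi.
  by apply: is_derive_eq; rewrite scale0r addr0.
have dq : is_derive (0 : R) 1 (fun t => (q + t * enorm w) ^+ p.+1)
    (p.+1%:R * q ^+ p * enorm w).
  have -> : (fun t : R => (q + t * enorm w) ^+ p.+1) =
      (cst q + enorm w \*: @id R) ^+ p.+1.
    by apply/funext => t; rewrite exprfctE /= [_ * enorm w]mulrC.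
  apply: is_derive_eq; rewrite add0r [_%:A]mulr1.
  by rewrite !fctE /= scaler0 addr0.
have dH : is_derive (0 : R) 1 H ((2 * enorm (F y))^-1 * (- 2 * enorm w ^+ 2) +
   mu / p.+1`!%:R * (p.+1%:R * q ^+ p * enorm w)).
  rewrite (_ : H = (2 * enorm (F y))^-1 \*: S +
    (mu / p.+1`!%:R) \*: (fun t => (q + t * enorm w) ^+ p.+1))//.
  by apply: is_deriveD; exact: is_deriveZ.
have := is_derive_ge0_at_right dH Hmin.
have [->|w0] := eqVneq w 0.
  by rewrite enorm0 !mulr_ge0 ?exprn_ge0 ?enorm_ge0// invr_ge0.
(* The slope of [H] at 0 is a positive factor times the difference of the two sides of the claim. *)
have -> : (2 * enorm (F y))^-1 * (- 2 * enorm w ^+ 2) +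
   mu / p.+1`!%:R * (p.+1%:R * q ^+ p * enorm w) =
   enorm w / enorm (F y) * (mu / p`!%:R * q ^+ p * enorm (F y) - enorm w).
  rewrite factS natrM; field.
  by rewrite ?natr1 ?nat1r !pnatr_eq0 -lt0n fact_gt0 gt_eqF.
by rewrite pmulr_rge0 ?subr_ge0// divr_gt0// enorm_gt0.
Qed.

End stationarity.

(** * Comparison of the model with the objective *)

Section rhota.
Context {R : realType}.

Lemma taylor_self p n m (F : 'rV[R]_n -> 'rV[R]_m) x : taylor p F x x = F x.
Proof.
apply/rowP => i; rewrite mxE /taylor1 subrr big_add1 big_mkord big1 ?addr0// =>
  j _.
by rewrite /= derive0 mulr0.
Qed.

(** Trades real exponents for natural ones, in the radius [D k] and in the exponent [(p + 1) / p] of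
    [Csigma]. *)
Lemma exprn_powR_ratio (a : R) k l : 0 <= a -> (0 < k)%N ->
  (a ^+ k) `^ (l%:R / k%:R) = a ^+ l.
Proof.
move=> a0 k0; rewrite -!powR_mulrn// -powRrM mulrC divfK//.
by rewrite pnatr_eq0 -lt0n.
Qed.

Lemma smodel_self p n m (F : 'rV[R]_n -> 'rV[R]_m) M x :
  smodel p F M x x = enorm (F x).
Proof. by rewrite /smodel taylor_self subrr enorm0 expr0n mulr0 addr0. Qed.

Lemma smodel_ge0 p n m (F : 'rV[R]_n -> 'rV[R]_m) M x y :
  0 <= M -> 0 <= smodel p F M y x.
Proof.
by move=> M0; rewrite addr_ge0 ?mulr_ge0 ?invr_ge0 ?exprn_ge0 ?enorm_ge0.
Qed.

(** Taylor's bound with the triangle inequality in both directions. *)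
Lemma enorm_smodel_dist p n m (F : 'rV[R]_n -> 'rV[R]_m) (L : 'rV[R]_m) M x y :
  (forall i, times_differentiable p (fun z => F z 0 i)) ->
  (forall i, lipschitz_deriv p (fun z => F z 0 i) (L 0 i)) ->
  let c := enorm (y - x) ^+ p.+1 / p.+1`!%:R in
  enorm (F y) + (M - enorm L) * c <= smodel p F M y x /\
  smodel p F M y x <= enorm (F y) + (M + enorm L) * c.
Proof.
move=> dF lF c; have := taylor_le x y dF lF.
have -> : smodel p F M y x = enorm (taylor p F y x) + M * c.
  by rewrite /smodel /c mulrAC mulrA.
rewrite mulrAC -mulrA -/c => h.
have h1 := ler_enormD (F y - taylor p F y x) (taylor p F y x).
have h2 := ler_enormD (taylor p F y x - F y) (F y).
rewrite !subrK in h1 h2.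
have e : enorm (taylor p F y x - F y) = enorm (F y - taylor p F y x).
  by rewrite -opprB -scaleN1r enormZ normrN1 mul1r.
by rewrite e in h2; split; lra.
Qed.

End rhota.

(** * Uniform decrease of the objective and finite termination *)

Theorem theorem6p1 (R : realType) (p n m : nat)
    (F : 'rV[R]_n -> 'rV[R]_m) (L : 'rV[R]_m) (fstar M mu delta sigma : R)
    (x y : nat -> 'rV[R]_n)
    (f := fun z : 'rV[R]_n => enorm (F z))
    (D := fun k : nat =>
       ((p.+1)`!%:R / mu * (f (x k) - fstar)) `^ (p.+1%:R)^-1)
    (Lmu := (mu + delta + enorm L - M) / (mu - (M + enorm L)))
    (Csigma := (M - enorm L) / ((p.+1)`!%:R * Lmu)
               * (p`!%:R * sigma / mu) `^ (p.+1%:R / p%:R)) :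
  (1 <= p)%N ->
  (m <= n)%N ->
  (forall i, times_differentiable p (fun z => F z 0 i)) ->
  (forall i, lipschitz_deriv p (fun z => F z 0 i) (L 0 i)) ->
  (exists z, F z = 0) ->
  (forall z, fstar <= f z) ->
  0 < M ->
  0 < M - enorm L ->
  rhota p F M x ->
  M + enorm L < mu ->
  (forall k, is_argmin
     (fun z => f z + mu / (p.+1)`!%:R * enorm (z - x k) ^+ p.+1) (y k.+1)) ->
  0 <= delta ->
  (forall k,
     smodel p F M (x k.+1) (x k)
       - inf [set smodel p F M z (x k) | z in [set z | enorm (z - x k) <= D k]]
     <= delta / (p.+1)`!%:R * enorm (x k.+1 - x k) ^+ p.+1) ->
  0 < sigma ->
  (forall z, f z <= f (x 0%N) -> sigma <= sigma_min (jac F z)) ->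
  exists k : nat,
    k%:Z <= Num.ceil (f (x 0%N) / Csigma) /\
    (F (x k) = 0 \/ (1 <= k)%N /\ F (y k) = 0).
Proof.
move=> p1 _ dF lF _ fstar_le M0 ML0 xrhota Mmu ymin delta0 inexact sigma0.
move=> nondeg.
set N : R := p.+1`!%:R in D Csigma ymin inexact *.
have N0 : 0 < N by rewrite ltr0n fact_gt0.
have L0 : 0 <= enorm L := enorm_ge0 _.
have mu0 : 0 < mu by lra.
have gap0 : 0 < mu - (M + enorm L) by rewrite subr_gt0.
have Lmu0 : 0 < Lmu by rewrite divr_gt0//; lra.
have LmuE : Lmu * (mu - (M + enorm L)) = mu + delta + enorm L - M.
  by rewrite divfK// gt_eqF.
pose r k := enorm (x k.+1 - x k) ^+ p.+1.
pose q k := enorm (y k.+1 - x k).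
have r0 k : 0 <= r k by rewrite exprn_ge0// enorm_ge0.
have q0 k : 0 <= q k ^+ p.+1 by rewrite exprn_ge0// enorm_ge0.
have descent k : f (x k.+1) + (M - enorm L) * (r k / N) <= f (x k).
  have [h _] := enorm_smodel_dist M (x k) (x k.+1) dF lF.
  by apply: le_trans h _; apply: le_trans (xrhota k) _; rewrite smodel_self.
have level k : f (x k) <= f (x 0%N).
  elim: k => // k; apply: le_trans; apply: le_trans (descent k).
  by rewrite lerDl mulr_ge0 ?divr_ge0// ltW.
have ydescent k : f (y k.+1) + mu * (q k ^+ p.+1 / N) <= f (x k).
  have := ymin k (x k); rewrite subrr enorm0 expr0n mulr0 addr0 -/(q k).
  by rewrite mulrAC -mulrA.
have q_le k : q k ^+ p.+1 <= Lmu * r k.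
  (* [ydescent] and [fstar <= f (y k.+1)] put the proximal point in the ball, so it competes in the
     infimum. *)
  have yD : enorm (y k.+1 - x k) <= D k.
    rewrite -/(q k) -[q k]expr1 -(@exprn_powR_ratio _ _ p.+1 1) ?enorm_ge0//.
    rewrite div1r.
    have qN : q k ^+ p.+1 <= N / mu * (f (x k) - fstar).
      rewrite mulrAC ler_pdivlMr// -ler_pdivrMl//.
      by have := ydescent k; have := fstar_le (y k.+1); lra.
    by rewrite ge0_ler_powR ?nnegrE ?(le_trans _ qN)// invr_ge0.
  have yball :
    [set smodel p F M z (x k) | z in [set z | enorm (z - x k) <= D k]]
      (smodel p F M (y k.+1) (x k)) by exists (y k.+1).
  have lb : has_lbound
      [set smodel p F M z (x k) | z in [set z | enorm (z - x k) <= D k]].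
    by exists 0 => _ [z _ <-]; apply: smodel_ge0; exact: ltW.
  have := ge_inf lb yball; have := inexact k; rewrite mulrAC -mulrA -/(r k).
  have := ymin k (x k.+1); rewrite /= -/(q k) -/(r k).
  have [h1 _] := enorm_smodel_dist M (x k) (x k.+1) dF lF.
  have [_ h2] := enorm_smodel_dist M (x k) (y k.+1) dF lF.
  rewrite -/N -/(r k) -/(q k) in h1 h2 *.
  (* Chaining [h1], [h4], [h5], [h2] bounds [f (x k.+1) - f (y k.+1)] from above, [h3] bounds it
     from below; collecting the terms in [q k ^+ p.+1] leaves the factor [mu - (M + enorm L)]. *)
  move=> h3 h4 h5.
  rewrite -(ler_pM2r gap0) [Lmu * _ * _]mulrAC LmuE
    -(ler_pM2r (_ : 0 < N^-1)) ?invr_gt0//.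
  rewrite /f in h3; lra.
have step k : F (y k.+1) != 0 -> f (x k.+1) <= f (x k) - Csigma.
  move=> Fy0.
  have dFy : differentiable F (y k.+1).
    by apply: differentiable_row => i; exact: (dF i [::]).
  have jac_le := argmin_jac_le (ltW mu0) dFy Fy0 (ymin k).
  (* Nondegeneracy is only available on the initial level set. *)
  have ylevel : f (y k.+1) <= f (x 0%N).
    apply: le_trans (level k); apply: le_trans (ydescent k).
    by rewrite lerDl mulr_ge0 ?divr_ge0// ltW.
  have sle : sigma * enorm (F (y k.+1)) <= enorm (F (y k.+1) *m jac F (y k.+1)).
    apply: le_trans (sigma_min_le _ _).
    by rewrite ler_wpM2r ?enorm_ge0// nondeg.
  have qp : p`!%:R * sigma / mu <= q k ^+ p.
    have := le_trans sle jac_le; rewrite ler_pM2r ?enorm_gt0// -/(q k) => h.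
    rewrite ler_pdivrMr// mulrC -ler_pdivlMr ?ltr0n ?fact_gt0//.
    by lra.
  have qp1 : (p`!%:R * sigma / mu) `^ (p.+1%:R / p%:R) <= q k ^+ p.+1.
    rewrite -(@exprn_powR_ratio _ _ p) ?enorm_ge0//.
    rewrite ge0_ler_powR ?nnegrE ?divr_ge0 ?mulr_ge0 ?ler0n ?(ltW sigma0)
      ?(ltW mu0)//.
    by rewrite exprn_ge0// enorm_ge0.
  apply: le_trans (_ : f (x k) - (M - enorm L) * (r k / N) <= _).
    by rewrite lerBrDr descent.
  rewrite lerD2l lerN2 /Csigma.
  (* Exposes the prefactor of [Csigma], leaving [Lmu * r k], which dominates [q k ^+ p.+1]. *)
  have -> : (M - enorm L) * (r k / N) = (M - enorm L) / (N * Lmu) * (Lmu * r k).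
    by field; rewrite !lt0r_neq0.
  apply: ler_wpM2l; first by rewrite ltW// divr_gt0// mulr_gt0.
  exact: le_trans qp1 (q_le k).
have Csigma0 : 0 < Csigma.
  rewrite /Csigma mulr_gt0//; first by rewrite divr_gt0// mulr_gt0.
  by rewrite powR_gt0// divr_gt0// mulr_gt0// ltr0n fact_gt0.
(* The ceiling is nonnegative, so the absolute value only changes its type. *)
pose K := `|Num.ceil (f (x 0%N) / Csigma)|%N.
have KE : K%:Z = Num.ceil (f (x 0%N) / Csigma).
  by rewrite gez0_abs// ceil_ge0 (lt_le_trans (ltrN10 _))// divr_ge0
    ?enorm_ge0 ?ltW.
(* Step [k] involves [y k.+1], so if none of [y 1], ..., [y K] is a root, the first [K] steps each
   gain [Csigma]. *)
have [[j [j1 jK Fy]]|Fy0] := pselect (exists j,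
    [/\ (1 <= j)%N, (j <= K)%N & F (y j) = 0]).
  by exists j; split; [rewrite -KE lez_nat|right].
exists K; split; first by rewrite KE.
left; have fK k : (k <= K)%N -> f (x k) <= f (x 0%N) - k%:R * Csigma.
  elim: k => [_|k IH kK]; first by rewrite mul0r subr0.
  have Fyk : F (y k.+1) != 0 by apply/eqP => Fy; apply: Fy0; exists k.+1.
  by have := step k Fyk; have := IH (ltnW kK); rewrite -natr1 mulrDl mul1r; lra.
apply/eqP; rewrite -enorm_eq0 eq_le enorm_ge0 andbT.
(* After [K] steps the guaranteed decrease is at least [f (x 0)]. *)
apply: le_trans (fK K (leqnn K)) _; rewrite subr_le0 -ler_pdivrMr//.
by rewrite -[K%:R]/(K%:Z%:~R) KE ceil_ge.
Qed.
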